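(* Let $G$ and $H$ be finite simple graphs. The following are equivalent: (1) $G$ and $H$ are singularly cospectral; (2) $f_G(p)=f_H(p)$ for all $p\ge 1$; (3) $f_G(x_n)=f_H(x_n)$ for every sequence $(x_n)_{n\in\mathbb{N}}$ of real numbers with $x_n\ge 1$ for all $n$ and $x_n\to\infty$.
   Context: All graphs are finite, without loops or multiple edges; $A_G$ is the adjacency matrix of $G$, with $|V(G)|=n_G$. The singular values $s_1(G)\ge\cdots\ge s_{n_G}(G)$ of $G$ are those of $A_G$ (equivalently the absolute values of its eigenvalues). For $p\ge 1$, $f_G(p)=\bigl(\sum_{i=1}^{n_G} s_i(G)^p\bigr)^{1/p}$ (the Schatten $p$-norm of $A_G$). Two graphs are singularly cospectral if they have the same nonzero singular values with the same multiplicities. *)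

(* Defs.v *)
From HB Require Import structures.
From mathcomp Require Import all_boot all_order all_algebra.
From mathcomp Require Import polyrcf complex spectral.
From mathcomp Require Import all_classical all_reals all_analysis.

Set Implicit Arguments.
Unset Strict Implicit.
Unset Printing Implicit Defensive.

Import Order.TTheory GRing.Theory Num.Theory.
Local Open Scope ring_scope.

Record sgraph := SGraph {
  vertex :> finType;
  adj : rel vertex;
  adj_sym : symmetric adj;
  adj_irrefl : irreflexive adj }.

Section SingularValues.
Variable R : realType.

Definition adjmx (G : sgraph) : 'M[R]_#|G| :=
  \matrix_(i, j) (adj (enum_val i : G) (enum_val j))%:R.

(* [rootsR p] lists each real root of [p] once; [mup x p] is its multiplicity. *)
Definition real_eigenvalues n (B : 'M[R]_n) : seq R :=
  let p := char_poly B in flatten [seq nseq (mup x p) x | x <- rootsR p].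

Definition singular_values n (A : 'M[R]_n) : seq R :=
  sort >=%R [seq Num.sqrt x | x <- real_eigenvalues (A^T *m A)].

Definition singularly_cospectral (G H : sgraph) : Prop :=
  forall s : R, s != 0 ->
    count_mem s (singular_values (adjmx G))
    = count_mem s (singular_values (adjmx H)).

Definition schatten (G : sgraph) (p : R) : R :=
  (\sum_(s <- singular_values (adjmx G)) s `^ p) `^ p^-1.

Lemma char_poly_simmx (F : fieldType) n (P A B : 'M[F]_n) :
  P \in unitmx -> P *m A = B *m P -> char_poly A = char_poly B.
Proof.
move=> Pu PA; pose P' := map_mx polyC P.
have dP' : \det P' != 0.
  by rewrite det_map_mx polyC_eq0 -unitfE -unitmxE.
apply: (mulfI dP'); rewrite /char_poly -det_mulmx [RHS]mulrC -det_mulmx.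
congr (\det _); rewrite /char_poly_mx mulmxBr mulmxBl -!map_mxM PA.
by rewrite scalar_mxC.
Qed.

Lemma char_poly_sym_split n (B : 'M[R]_n) : B^T = B ->
  exists s : seq R, char_poly B = \prod_(x <- s) ('X - x%:P).
Proof.
move=> Bsym; pose C : numClosedFieldType := complex.complex R.
pose f : {rmorphism R -> C} := complex.real_complex R.
pose BC : 'M[C]_n := map_mx f B.
have fr x : f x \is Num.real.
  apply/Creal_ImP; exact: (esym (complex.complexIm (complex.real_complex R x))).
have BCh : BC \is hermsymmx.
  apply: realsym_hermsym; last by apply/mxOverP => i j; rewrite mxE.
  apply/is_hermitianmxP; rewrite /= expr0 scale1r map_mx_id //.
  by rewrite /BC map_trmx Bsym.
have /orthomx_spectralP/= E := hermitian_normalmx BCh.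
have /mxOverP Sr := hermitian_spectral_diag_real BCh.
have Pu := spectral_unit BC.
exists [seq complex.Re (spectral_diag BC 0 i) | i : 'I_n].
apply: (map_poly_inj f); rewrite map_char_poly -/BC rmorph_prod big_map /=.
rewrite big_enum /=.
rewrite (@char_poly_simmx _ _ (spectralmx BC) _ (diag_mx (spectral_diag BC))) //.
  rewrite char_poly_trig ?diag_mx_is_trig //; apply: eq_bigr => i _.
  rewrite mxE eqxx mulr1n rmorphB /= map_polyX map_polyC /=; congr (_ - _%:P).
  exact: (esym (complex.RRe_real (Sr 0 i))).
by rewrite {2}E !mulmxA mulmxV // mul1mx.
Qed.

Lemma perm_real_eigenvalues n (B : 'M[R]_n) (s : seq R) :
  char_poly B = \prod_(x <- s) ('X - x%:P) -> perm_eq (real_eigenvalues B) s.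
Proof.
move=> E; apply/allP => x _ /=; apply/eqP.
rewrite /real_eigenvalues E count_flatten -map_comp.
under eq_map => y do rewrite /= count_nseq mu_prod_XsubC /=.
have pn0 : \prod_(x <- s) ('X - x%:P) != 0 by rewrite -E monic_neq0 ?char_poly_monic.
have ur : uniq (rootsR (\prod_(x <- s) ('X - x%:P))) by exact: uniq_roots.
have mr : x \in rootsR (\prod_(x <- s) ('X - x%:P)) = (x \in s).
  by rewrite -(roots_on_rootsR pn0) inE /= root_prod_XsubC.
rewrite sumnE big_map; have [xs|xs] := boolP (x \in s).
  rewrite (bigD1_seq x) ?mr //= eqxx mul1n big1 ?addn0 // => y /negPf.
  by rewrite eq_sym => ->; rewrite mul0n.
rewrite big1_seq ?(count_memPn xs) // => y /andP[_ yr].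
by case: eqP => [yx|_]; rewrite ?mul0n // yx mr (negPf xs) in yr.
Qed.
Lemma eigenvalue_gram_ge0 n (A : 'M[R]_n) (a : R) :
  eigenvalue (A^T *m A) a -> 0 <= a.
Proof.
move=> /eigenvalueP[v vA v0].
pose sq m (w : 'rV[R]_m) := (w *m w^T) 0 0.
have sqE m (w : 'rV[R]_m) : sq m w = \sum_i w 0 i ^+ 2.
  by rewrite /sq mxE; apply: eq_bigr => i _; rewrite mxE expr2.
have sq_ge0 m (w : 'rV[R]_m) : 0 <= sq m w.
  by rewrite sqE; apply: sumr_ge0 => i _; exact: sqr_ge0.
have sqv : 0 < sq _ v.
  rewrite lt_neqAle sq_ge0 andbT eq_sym sqE psumr_neq0; last first.
    by move=> i _; exact: sqr_ge0.
  have /rV0Pn[i vi] := v0.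
  apply/hasP; exists i; first exact: mem_index_enum.
  by rewrite /= lt_def sqr_ge0 sqrf_eq0 vi.
rewrite -(pmulr_lge0 _ sqv); have -> : a * sq _ v = sq _ (v *m A^T).
  rewrite /sq trmx_mul trmxK mulmxA -(mulmxA v) vA.
  by rewrite -scalemxAl [RHS]mxE.
exact: sq_ge0.
Qed.

(* The singular values are [n] in number and their squares are, with
   multiplicity, the roots of the characteristic polynomial of [A^T *m A]. *)
Lemma char_poly_singular_values n (A : 'M[R]_n) :
  char_poly (A^T *m A) = \prod_(s <- singular_values A) ('X - (s ^+ 2)%:P).
Proof.
have [|s E] := @char_poly_sym_split _ (A^T *m A).
  by rewrite trmx_mul trmxK.
have peq := perm_real_eigenvalues E.
rewrite (perm_big _ (permEl (perm_sort _ _))) /= big_map (perm_big _ peq) /= E.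
rewrite [LHS]big_seq [RHS]big_seq; apply: eq_bigr => x xs.
rewrite sqr_sqrtr // (@eigenvalue_gram_ge0 _ A) //.
by rewrite eigenvalue_root_char E root_prod_XsubC.
Qed.

Lemma size_singular_values n (A : 'M[R]_n) : size (singular_values A) = n.
Proof.
have := size_char_poly (A^T *m A); rewrite char_poly_singular_values.
by rewrite -(big_map (fun s => s ^+ 2) predT (fun y => 'X - y%:P))
  size_prod_XsubC size_map => -[].
Qed.

End SingularValues.

(* Main.v *)
Require Import Defs.
From mathcomp Require Import all_boot all_order all_algebra.
From mathcomp Require Import all_classical all_reals all_analysis.

Import Order.TTheory GRing.Theory Num.Theory.
Import numFieldNormedType.Exports.
Local Open Scope classical_set_scope.
Local Open Scope ring_scope.

(** Since [0 `^ p = 0] for [p >= 1], only the nonzero singular values contribute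
    to a Schatten norm, and the sum of the [s `^ p] is recovered from the norm.
    Conversely, integer exponents already suffice: they determine the sum of
    [q.[s]] over the singular values for every polynomial [q] without constant
    term, and a [q] vanishing at [0] and at all singular values but one reads
    off the multiplicity of that one. For (3) => (2), a given exponent [p] is
    the first term of the sequence [p + n]. *)

Lemma eq_sum_horner (R : comNzRingType) (l1 l2 : seq R) (q : {poly R}) :
  (forall k, \sum_(x <- l1) x ^+ k.+1 = \sum_(x <- l2) x ^+ k.+1) ->
  q`_0 = 0 -> \sum_(x <- l1) q.[x] = \sum_(x <- l2) q.[x].
Proof.
move=> eq_pow q0; under eq_bigr do rewrite horner_coef.
under [RHS]eq_bigr do rewrite horner_coef.
rewrite exchange_big [RHS]exchange_big /=; apply: eq_bigr => -[[|k] kq] _ /=.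
  by rewrite !big1 // => x _; rewrite q0 mul0r.
by rewrite -!mulr_sumr eq_pow.
Qed.

Lemma power_sums_count_mem (R : numDomainType) (l1 l2 : seq R) :
  (forall k, \sum_(x <- l1) x ^+ k.+1 = \sum_(x <- l2) x ^+ k.+1) ->
  forall s, s != 0 -> count_mem s l1 = count_mem s l2.
Proof.
move=> eq_pow s s0.
(* [s] may be absent from both lists; in any case [r] omits it, so [q.[s]] is nonzero as [s != 0].
   Repeated roots of [q] are harmless. *)
pose r := [seq y <- l1 ++ l2 | y != s].
pose q := 'X * \prod_(y <- r) ('X - y%:P).
have qs : q.[s] != 0.
  rewrite hornerM hornerX mulf_neq0 // -/(root _ _) root_prod_XsubC.
  by rewrite mem_filter eqxx.
have sum_q l : {subset l <= l1 ++ l2} ->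
    \sum_(x <- l) q.[x] = q.[s] *+ count_mem s l.
  (* Read backwards, the multiple is a sum of the constant [q.[s]] over the entries equal to [s],
     which is compared term by term. *)
  move=> sl; rewrite -iter_addr_0 -big_const_seq.
  rewrite [RHS]big_mkcond [LHS]big_seq [RHS]big_seq; apply: eq_bigr => x xl /=.
  case: (eqVneq x s) => [->//|xs]; apply/eqP.
  rewrite hornerM mulf_eq0 -/(root (\prod_(y <- r) _) x).
  by rewrite root_prod_XsubC mem_filter xs sl // orbT.
have := @eq_sum_horner R l1 l2 q eq_pow; rewrite coefXM eqxx => /(_ erefl).
rewrite !sum_q; do ?by move=> x xl; rewrite mem_cat xl ?orbT.
(* After cancelling [q.[s]], characteristic zero makes the cast from naturals injective. *)
by move/eqP; rewrite -mulr_natr -[X in _ == X]mulr_natr (inj_eq (mulfI qs))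
  eqr_nat => /eqP.
Qed.

(** The lists may differ in their number of zeros, as for graphs of different orders. Since
    [F 0 = 0], zeros can be filtered out, and what remains agrees up to permutation. *)
Lemma eq_sum_count_mem_neq0 (R V : nmodType) (l1 l2 : seq R) (F : R -> V) :
  F 0 = 0 -> (forall s, s != 0 -> count_mem s l1 = count_mem s l2) ->
  \sum_(s <- l1) F s = \sum_(s <- l2) F s.
Proof.
move=> F0 eq_mult.
have nz l : \sum_(s <- l) F s = \sum_(s <- [seq s <- l | s != 0]) F s.
  rewrite big_filter [RHS]big_mkcond; apply: eq_bigr => s _.
  by case: eqP => // ->.
rewrite nz [RHS]nz; apply: perm_big; apply/allP => s _ /=; rewrite !count_filter.
apply/eqP; case: (eqVneq s 0) => [->|s0].
  have E : [predI pred1 0 & (fun x : R => x != 0)] =1 pred0.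
    by move=> x; exact: andbN.
  by rewrite !(eq_count E) !count_pred0.
have E : [predI pred1 s & (fun x => x != 0)] =1 pred1 s.
  by move=> x; apply: andb_idr => /eqP ->.
by rewrite !(eq_count E) eq_mult.
Qed.

Lemma singular_values_ge0 (R : realType) n (A : 'M[R]_n) s :
  s \in singular_values A -> 0 <= s.
Proof. by rewrite mem_sort => /mapP[x _ ->]; exact: sqrtr_ge0. Qed.

Lemma schatten_powR (R : realType) (G : sgraph) (p : R) : p != 0 ->
  schatten G p `^ p = \sum_(s <- singular_values (adjmx R G)) s `^ p.
Proof.
move=> p0; rewrite /schatten -powRrM mulVf // powRr1 //.
by apply: sumr_ge0 => s _; exact: powR_ge0.
Qed.

Theorem theorem3p5 (R : realType) (G H : sgraph) :
  (singularly_cospectral R G H <->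
   (forall p : R, 1 <= p -> schatten G p = schatten H p)) /\
  ((forall p : R, 1 <= p -> schatten G p = schatten H p) <->
   (forall x : nat -> R,
      (forall n, 1 <= x n) -> x n @[n --> \oo] --> +oo ->
      forall n, schatten G (x n) = schatten H (x n))).
Proof.
split; split.
- move=> cosp p p1; congr (_ `^ _); apply: eq_sum_count_mem_neq0 cosp.
  (* The exponent must be nonzero, since [powR] sends zero to the power zero to one. *)
  by rewrite powR0 // gt_eqF // (lt_le_trans ltr01).
- move=> eq_norm; apply: power_sums_count_mem => k.
  have sumE K : \sum_(s <- singular_values (adjmx R K)) s ^+ k.+1 =
      schatten K k.+1%:R `^ k.+1%:R.
    rewrite schatten_powR ?pnatr_eq0 // big_seq [RHS]big_seq.
    (* Real and integer powers agree on nonnegative bases. *)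
    by apply: eq_bigr => s /singular_values_ge0 s0; rewrite powR_mulrn.
  by rewrite !sumE eq_norm // ler1n.
- by move=> eq_norm x x1 _ n; exact: eq_norm.
- move=> eq_norm p p1; rewrite -(addr0 p).
  apply: (eq_norm (fun n => p + n%:R) _ _ 0%N) => [n|].
    by rewrite (le_trans p1) // lerDl.
  apply/cvgryPge => A; near=> n; rewrite -lerBlDl.
  by near: n; exact: nbhs_infty_ger.
Unshelve. all: by end_near.
Qed.
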